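(* Let $(\mathsf{V},\mathsf{E})$ be a finite, oriented, connected graph with positive vertex weights $\mathsf{w}\in\mathbb{R}^{\mathsf{V}}_{>0}$ and positive edge weights $\mathsf{W}\in\mathbb{R}^{\mathsf{E}}_{>0}$, let $\mathsf{J}$ be the total variation on this weighted graph, let $\mathsf{f}\in\mathbb{R}^{\mathsf{V}}$ and $\alpha>0$, and let $\mathsf{u}_{\mathsf{f}}$ be the unique minimizer over $\mathsf{u}\in\mathbb{R}^{\mathsf{V}}$ of $$\tfrac12\sum_{\mathsf{v}\in\mathsf{V}}\mathsf{w}(\mathsf{v})|\mathsf{f}(\mathsf{v})-\mathsf{u}(\mathsf{v})|^2+\alpha\,\mathsf{J}(\mathsf{u}).$$ Then for every convex function $\varphi:\mathbb{R}\to\mathbb{R}$, $$\mathsf{u}_{\mathsf{f}}\in\operatorname*{arg\,min}_{\mathsf{u}\in\mathsf{f}-\alpha\partial\mathsf{J}(0)}\ \sum_{\mathsf{v}\in\mathsf{V}}\varphi(\mathsf{u}(\mathsf{v}))\,\mathsf{w}(\mathsf{v}).$$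
   Context: Finite, oriented, connected graph means: $\mathsf{V}$ is a finite set, $\mathsf{E}\subset\mathsf{V}\times\mathsf{V}$; if $(\mathsf{v}_i,\mathsf{v}_j)\in\mathsf{E}$ then $(\mathsf{v}_j,\mathsf{v}_i)\notin\mathsf{E}$; and every pair of vertices is connected by a path ignoring edge orientation. $\mathbb{R}^{\mathsf{V}}$, $\mathbb{R}^{\mathsf{E}}$ are the spaces of real-valued functions on $\mathsf{V}$, $\mathsf{E}$. The weighted inner product on $\mathbb{R}^{\mathsf{V}}$ is $\langle\mathsf{g},\mathsf{h}\rangle_{\mathsf{w}}=\sum_{\mathsf{v}\in\mathsf{V}}\mathsf{w}(\mathsf{v})\mathsf{g}(\mathsf{v})\mathsf{h}(\mathsf{v})$. The divergence $\mathsf{div}:\mathbb{R}^{\mathsf{E}}\to\mathbb{R}^{\mathsf{V}}$ is $$\mathsf{div}\,\mathsf{H}(\mathsf{v})=\frac1{\mathsf{w}(\mathsf{v})}\Big(\sum_{\mathsf{e}=(\bar{\mathsf{v}},\mathsf{v})\in\mathsf{E}}\mathsf{W}(\mathsf{e})\mathsf{H}(\mathsf{e})-\sum_{\mathsf{e}=(\mathsf{v},\bar{\mathsf{v}})\in\mathsf{E}}\mathsf{W}(\mathsf{e})\mathsf{H}(\mathsf{e})\Big).$$ With $\mathsf{B}=\{\mathsf{H}\in\mathbb{R}^{\mathsf{E}}:-1\le\mathsf{H}\le1\}$, the total variation on the weighted graph is $\mathsf{J}(\mathsf{u})=\sup_{\mathsf{h}\in\mathsf{div}(\mathsf{B})}\langle\mathsf{u},\mathsf{h}\rangle_{\mathsf{w}}$.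 The subdifferential is taken with respect to $\langle\cdot,\cdot\rangle_{\mathsf{w}}$: $\partial\mathsf{J}(0)=\{\mathsf{p}\in\mathbb{R}^{\mathsf{V}}:\langle\mathsf{p},\mathsf{g}\rangle_{\mathsf{w}}\le\mathsf{J}(\mathsf{g})\text{ for all }\mathsf{g}\in\mathbb{R}^{\mathsf{V}}\}$. $\operatorname{arg\,min}$ denotes the set of minimizers. *)

(* Defs.v *)
From mathcomp Require Import all_boot all_order all_algebra.
From mathcomp Require Import all_classical all_reals all_analysis.

Set Implicit Arguments.
Unset Strict Implicit.
Unset Printing Implicit Defensive.

Import Order.TTheory GRing.Theory Num.Theory.

Local Open Scope classical_set_scope.
Local Open Scope ring_scope.

(* In particular, an oriented edge set contains no loop. *)
Definition oriented (V : finType) (E : {set V * V}) : Prop :=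
  forall x y : V, (x, y) \in E -> (y, x) \notin E.

Definition connected_graph (V : finType) (E : {set V * V}) : Prop :=
  forall x y : V,
    connect (fun a b : V => ((a, b) \in E) || ((b, a) \in E)) x y.

Definition edge (V : finType) (E : {set V * V}) : finType :=
  {e : V * V | e \in E}.

Definition argmin (R : realType) (T : Type) (A : set T) (F : T -> R) : set T :=
  [set x | A x /\ forall y, A y -> F x <= F y].

Definition wdot (R : realType) (V : finType) (w g h : {ffun V -> R}) : R :=
  \sum_(v : V) w v * g v * h v.

Definition gdiv (R : realType) (V : finType) (E : {set V * V})
    (w : {ffun V -> R}) (W H : {ffun edge E -> R}) : {ffun V -> R} :=
  [ffun v => (w v)^-1 *
     (\sum_(e : edge E | (val e).2 == v) W e * H e
      - \sum_(e : edge E | (val e).1 == v) W e * H e)].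

Definition edge_ball (R : realType) (V : finType) (E : {set V * V}) :
    set {ffun edge E -> R} :=
  [set H | forall e, -1 <= H e <= 1].

(* The set under [sup] is nonempty and bounded, so [sup] is the genuine
   supremum and not its default value. *)
Definition graph_tv (R : realType) (V : finType) (E : {set V * V})
    (w : {ffun V -> R}) (W : {ffun edge E -> R}) (u : {ffun V -> R}) : R :=
  sup [set wdot w u h | h in gdiv w W @` @edge_ball R V E].

(* The subdifferential at 0, with respect to [wdot w], of a functional
   vanishing at 0. *)
Definition subdiff0 (R : realType) (V : finType) (w : {ffun V -> R})
    (J : {ffun V -> R} -> R) : set {ffun V -> R} :=
  [set p | forall g, wdot w p g <= J g].

Definition rof_energy (R : realType) (V : finType) (w : {ffun V -> R})
    (J : {ffun V -> R} -> R) (f : {ffun V -> R}) (alpha : R)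
    (u : {ffun V -> R}) : R :=
  2^-1 * (\sum_(v : V) w v * `|f v - u v| ^+ 2) + alpha * J u.

(* Main.v *)
(* By compactness there is a flow H with -1 <= H <= 1 minimizing the weighted norm
   of the residual u = f - alpha div H. First-order optimality says that H maximizes
   <u, div K> over all such flows K, i.e. <u, div H> = J(u) with div H in the
   subdifferential of J at 0, so u is the ROF minimizer. Maximality is an edgewise
   condition on the signs of the increments of u, hence it persists when u is composed
   with a nondecreasing function sigma. Taking for sigma a selection of the
   subdifferential of phi, every p in the subdifferential of J at 0 satisfies
   <p, sigma(u)> <= J(sigma(u)) = <div H, sigma(u)>, and the subgradient inequality for
   phi at u, summed over the vertices, gives the claim. *)
Require Import Defs.
From mathcomp Require Import all_boot all_order all_algebra.
From mathcomp Require Import all_classical all_reals all_analysis.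
From mathcomp Require Import ring lra.

Import Order.TTheory GRing.Theory Num.Theory.
Local Open Scope classical_set_scope.
Local Open Scope ring_scope.

(** * Subgradients of convex functions on the line *)

Lemma convex_three_point (R : realType) (phi : R^o -> R^o) (x y z : R) :
  convex_function setT phi -> y < x -> x < z ->
  (z - y) * phi x <= (z - x) * phi y + (x - y) * phi z.
Proof.
move=> phi_convex yx xz.
have zy0 : 0 < z - y by lra.
have t01 : 0 <= (z - x) / (z - y) <= 1.
  by rewrite divr_ge0 ?ler_pdivrMr /=; lra.
pose t := Itv01 (proj1 (andP t01)) (proj2 (andP t01)).
have onemt : unstable.onem t%:num = (x - y) / (z - y).
  by rewrite /unstable.onem /=; field; lra.
have := phi_convex t y z; rewrite !inE => /(_ I I).
have -> : conv t (y : convex_lmodType R^o) z = x.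
  change (t%:num * y + unstable.onem t%:num * z = x).
  by rewrite onemt /=; field; lra.
rewrite convRE onemt /= => phix.
have -> : (z - x) * phi y + (x - y) * phi z =
    (z - y) * ((z - x) / (z - y) * phi y + (x - y) / (z - y) * phi z).
  by field; lra.
by rewrite ler_pM2l.
Qed.

(** Every chord slope to the left of [x] is at most every chord slope to its right, so the supremum
    of the left slopes is the slope of a supporting line at [x]. *)
Lemma convex_subgradient (R : realType) (phi : R^o -> R^o) :
  convex_function setT phi ->
  exists s : R -> R, forall x y : R, phi x + s x * (y - x) <= phi y.
Proof.
move=> phi_convex.
suff /choice[s sP] : forall x : R, exists s : R,
  forall y : R, phi x + s * (y - x) <= phi y by exists s.
move=> x.
pose S := [set ((phi x - phi y) / (x - y) : R) | y in [set y : R | y < x]].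
have S_ub z : x < z -> ubound S ((phi z - phi x) / (z - x)).
  move=> xz _ [y /= yx <-].
  have := @convex_three_point R phi x y z phi_convex yx xz.
  rewrite ler_pdivrMr ?subr_gt0// mulrAC ler_pdivlMr ?subr_gt0//.
  nra.
have S0 : S !=set0.
  by exists ((phi x - phi (x - 1)) / (x - (x - 1))), (x - 1) => //=; lra.
have S_has_ub : has_ubound S.
  by exists ((phi (x + 1) - phi x) / (x + 1 - x)); apply: S_ub; lra.
exists (sup S) => y; have [yx|xy|->] := ltgtP y x; last by rewrite subrr mulr0 addr0.
- have : (phi x - phi y) / (x - y) <= sup S by apply: ub_le_sup => //; exists y.
  by rewrite ler_pdivrMr ?subr_gt0//; nra.
- have : sup S <= (phi y - phi x) / (y - x) by apply: ge_sup => //; exact: S_ub.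
  by rewrite ler_pdivlMr ?subr_gt0//; nra.
Qed.

(** * Continuity of the dual objective *)

Section Continuity.
Import numFieldNormedType.Exports.

Lemma continuous_bigsum (R : realType) (T : topologicalType) (I : finType)
    (P : pred I) (F : I -> T -> R) :
  (forall i, continuous (F i)) -> continuous (fun x => \sum_(i | P i) F i x).
Proof.
move=> F_cont x.
have -> : (fun x => \sum_(i | P i) F i x) = \sum_(i | P i) F i.
  by apply/funext => y; rewrite fct_sumE.
elim/big_ind: _ => [|f g fx gx|i _].
- exact: cst_continuous.
- exact: continuousD.
- exact: F_cont.
Qed.

(** This is the shape of one vertex term of the dual objective: [S1] and [S2] are the inflow and
    outflow at a vertex of weight [k], and [b] is the inverse of that weight. *)
Lemma continuous_square_residual (R : realType) (T : topologicalType)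
    (S1 S2 : T -> R) (k c a b : R) :
  continuous S1 -> continuous S2 ->
  continuous (fun x => k * (c - a * (b * (S1 x - S2 x))) ^+ 2).
Proof.
move=> S1_cont S2_cont.
pose r : T -> R := cst c \- (cst a \* (cst b \* (S1 \- S2))).
have r_cont : continuous r.
  move=> x; apply: (@continuousB _ _ _ (cst c)); first exact: cst_continuous.
  apply: (@continuousM _ _ (cst a)); first exact: cst_continuous.
  apply: (@continuousM _ _ (cst b)); first exact: cst_continuous.
  by apply: (@continuousB _ _ _ S1); [exact: S1_cont|exact: S2_cont].
change (continuous (cst k \* (r \* r))) => x.
apply: (@continuousM _ _ (cst k)); first exact: cst_continuous.
by apply: (@continuousM _ _ r); exact: r_cont.
Qed.

End Continuity.

(** * Total variation and the flows attaining it *)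

Section WeightedGraph.
Set Implicit Arguments.
Unset Strict Implicit.
Context {R : realType} {V : finType} {E : {set V * V}}.
Implicit Types (w f g u : {ffun V -> R}) (W H K : {ffun edge E -> R}).

Lemma wdotC w f g : wdot w f g = wdot w g f.
Proof. by apply: eq_bigr => v _; rewrite mulrAC. Qed.

(** Summation by parts: the vertex weight cancels the inverse weight in [gdiv], and each edge is
    counted once at its head and once at its tail. *)
Lemma wdot_gdiv w W H g : (forall v, 0 < w v) ->
  wdot w g (gdiv w W H) = \sum_e W e * H e * (g (val e).2 - g (val e).1).
Proof.
move=> w_gt0.
pose head v := \sum_(e : edge E | (val e).2 == v) W e * H e * g (val e).2.
pose tail v := \sum_(e : edge E | (val e).1 == v) W e * H e * g (val e).1.
transitivity (\sum_v (head v - tail v)).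
  apply: eq_bigr => v _; rewrite ffunE.
  rewrite mulrCA -!mulrA mulKf ?gt_eqF// mulrBr !mulr_sumr.
  by congr (_ - _); apply: eq_bigr => e /eqP <-; rewrite mulrC.
have exch (h : edge E -> V) (G : edge E -> R) :
    \sum_v \sum_(e | h e == v) G e = \sum_e G e.
  rewrite (exchange_big_dep predT)//=; apply: eq_bigr => e _.
  by rewrite (eq_bigl (pred1 (h e))) ?big_pred1_eq// => v; rewrite eq_sym.
by rewrite sumrB /head /tail !exch -sumrB; apply: eq_bigr => e _; rewrite mulrBr.
Qed.

Lemma wdot_gdiv_bound w W g H : (forall v, 0 < w v) -> edge_ball H ->
  wdot w g (gdiv w W H) <= \sum_e `|W e * (g (val e).2 - g (val e).1)|.
Proof.
move=> w_gt0 H_ball; rewrite wdot_gdiv//; apply: ler_sum => e _.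
rewrite mulrAC (le_trans (ler_norm _))// normrM ler_piMr//.
by rewrite ler_norml; exact: H_ball.
Qed.

Lemma graph_tv_ge w W g H : (forall v, 0 < w v) -> edge_ball H ->
  wdot w g (gdiv w W H) <= graph_tv w W g.
Proof.
move=> w_gt0 H_ball; apply: ub_le_sup.
  exists (\sum_e `|W e * (g (val e).2 - g (val e).1)|) => _ [_ [K K_ball <-] <-].
  exact: wdot_gdiv_bound.
by exists (gdiv w W H) => //; exists H.
Qed.

Lemma graph_tv_le w W g c :
  (forall K, edge_ball K -> wdot w g (gdiv w W K) <= c) -> graph_tv w W g <= c.
Proof.
move=> c_ub; apply: ge_sup => [|_ [_ [K K_ball <-] <-]]; last exact: c_ub.
(* The zero flow provides the nonemptiness that [ge_sup] requires. *)
exists (wdot w g (gdiv w W [ffun=> 0])), (gdiv w W [ffun=> 0]) => //.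
by exists [ffun=> 0] => // e; rewrite ffunE lerN10 ler01.
Qed.

Lemma subdiff0_gdiv w W H : (forall v, 0 < w v) -> edge_ball H ->
  subdiff0 w (graph_tv w W) (gdiv w W H).
Proof. by move=> w_gt0 H_ball g; rewrite wdotC; exact: graph_tv_ge. Qed.

(** For [H] in the ball, this says that [H] attains the supremum defining the total variation of
    [u]. *)
Definition calibrates w W u H :=
  forall K, edge_ball K -> wdot w u (gdiv w W K) <= wdot w u (gdiv w W H).

(** Compare [H] with the flow that differs from it only at [e], where it takes the value [k]: all
    other edge terms cancel and the factor [W e] is positive. *)
Lemma calibrates_edge w W u H e k : (forall v, 0 < w v) -> (forall e, 0 < W e) ->
  edge_ball H -> calibrates w W u H -> -1 <= k <= 1 ->
  (k - H e) * (u (val e).2 - u (val e).1) <= 0.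
Proof.
move=> w_gt0 W_gt0 H_ball H_cal k1.
pose K := [ffun e' => if e' == e then k else H e'].
have : edge_ball K by move=> e'; rewrite ffunE; case: ifP.
move=> /H_cal; rewrite !wdot_gdiv// (bigD1 e)//= [leRHS](bigD1 e)//= !ffunE eqxx.
rewrite [X in _ + X](eq_bigr (fun e' => W e' * H e' * (u (val e').2 - u (val e').1))).
  by rewrite lerD2r -subr_le0 -mulrBl -mulrBr -mulrA pmulr_rle0.
by move=> e' /negPf; rewrite ffunE => ->.
Qed.

(** Across each edge the increment of [sigma] after [u] is zero or has the sign of the increment of
    [u], so the edgewise inequalities survive and can be summed. *)
Lemma calibrates_comp w W u H (sigma : R -> R) :
  (forall v, 0 < w v) -> (forall e, 0 < W e) ->
  edge_ball H -> calibrates w W u H -> {homo sigma : x y / x <= y} ->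
  calibrates w W [ffun v => sigma (u v)] H.
Proof.
move=> w_gt0 W_gt0 H_ball H_cal sigma_homo K K_ball.
rewrite !wdot_gdiv//; apply: ler_sum => e _; rewrite -!mulrA ler_pM2l//.
rewrite -subr_le0 -mulrBl !ffunE.
have := calibrates_edge e w_gt0 W_gt0 H_ball H_cal (K_ball e).
have [uu|uu|->] := ltgtP (u (val e).2) (u (val e).1); last by rewrite !subrr !mulr0.
- by have := sigma_homo _ _ (ltW uu); nra.
- by have := sigma_homo _ _ (ltW uu); nra.
Qed.

Lemma graph_tv_calibrates w W u H : (forall v, 0 < w v) -> edge_ball H ->
  calibrates w W u H -> graph_tv w W u = wdot w u (gdiv w W H).
Proof.
move=> w_gt0 H_ball H_cal; apply/le_anti.
by rewrite graph_tv_ge// andbT; exact: graph_tv_le.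
Qed.

(** * The dual problem and the ROF minimizer *)

Definition dual_residual w W f (alpha : R) H : {ffun V -> R} :=
  [ffun v => f v - alpha * gdiv w W H v].

Section DualMinimizer.
Import numFieldNormedType.Exports ArrowAsProduct.

Lemma dual_minimizer w W f (alpha : R) :
  exists2 H, edge_ball H & forall K, edge_ball K ->
    \sum_v w v * dual_residual w W f alpha H v ^+ 2 <=
    \sum_v w v * dual_residual w W f alpha K v ^+ 2.
Proof.
pose A := [set h : edge E -> R | forall e, `[-1, 1]%classic (h e)].
(* Tychonoff is applied to plain functions with the product topology; [finfun] carries the minimizer
   back. *)
have A_compact : compact A.
  apply: (@tychonoff _ (fun=> R) (fun=> `[-1, 1]%classic)) => e.
  exact: segment_compact.
pose F (h : edge E -> R) : R :=
  \sum_v w v * dual_residual w W f alpha (finfun h) v ^+ 2.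
have flow_cont (P : pred (edge E)) :
    continuous (fun h : edge E -> R => \sum_(e | P e) W e * h e).
  apply: continuous_bigsum => e h.
  apply: (@continuousM _ _ (cst (W e))); first exact: cst_continuous.
  exact: (@proj_continuous _ (fun=> R) e).
have F_cont : continuous F.
  have FE : F = fun h : edge E -> R => \sum_v w v * (f v - alpha * ((w v)^-1 *
      (\sum_(e : edge E | (val e).2 == v) W e * h e
       - \sum_(e : edge E | (val e).1 == v) W e * h e))) ^+ 2.
    apply/funext => h; apply: eq_bigr => v _; rewrite !ffunE.
    congr (_ * (_ - _ * (_ * (_ - _))) ^+ 2);
      by apply: eq_bigr => e _; rewrite ffunE.
  rewrite FE; apply: continuous_bigsum => v.
  exact: continuous_square_residual.
have A0 : A !=set0 by exists (fun=> 0) => e /=; rewrite in_itv /= lerN10 ler01.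
have [h] := compact_EVT_min A0 A_compact (continuous_subspaceT F_cont).
rewrite inE => hA h_min; exists (finfun h) => [e|K K_ball].
  by rewrite ffunE; have := hA e; rewrite /= in_itv.
have -> : K = finfun (K : edge E -> R) by apply/ffunP => e; rewrite ffunE.
by apply: h_min; rewrite inE => e /=; rewrite in_itv; exact: K_ball.
Qed.

End DualMinimizer.

Lemma calibrated_residual w W f (alpha : R) : (forall v, 0 < w v) -> 0 < alpha ->
  exists2 H, edge_ball H & calibrates w W (dual_residual w W f alpha H) H.
Proof.
move=> w_gt0 alpha_gt0.
have [H H_ball H_min] := dual_minimizer w W f alpha; exists H => // K K_ball.
set u := dual_residual _ _ _ _ _.
pose d v := gdiv w W K v - gdiv w W H v.
pose a := \sum_v w v * u v * d v; pose b := \sum_v w v * d v ^+ 2.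
have aE : a = wdot w u (gdiv w W K) - wdot w u (gdiv w W H).
  by rewrite /a /wdot -sumrB; apply: eq_bigr => v _; rewrite -mulrBr.
have b_ge0 : 0 <= b by apply: sumr_ge0 => v _; rewrite mulr_ge0 ?sqr_ge0// ltW.
rewrite -subr_le0 -aE.
(* Moving from [H] towards [K] by a fraction [t] changes the residual by [- alpha * t * d];
   expanding the square and using minimality of [H] gives the bound. *)
have step t : 0 <= t <= 1 -> 2 * alpha * t * a <= (alpha * t) ^+ 2 * b.
  move=> /andP[t0 t1].
  pose L : {ffun edge E -> R} := [ffun e => (1 - t) * H e + t * K e].
  have L_ball : edge_ball L.
    by move=> e; rewrite ffunE; have := H_ball e; have := K_ball e; nra.
  have := H_min _ L_ball.
  have -> : \sum_v w v * dual_residual w W f alpha L v ^+ 2 =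
      \sum_v w v * u v ^+ 2 - 2 * alpha * t * a + (alpha * t) ^+ 2 * b.
    rewrite /a /b !mulr_sumr -sumrB -big_split /=; apply: eq_bigr => v _.
    have -> : dual_residual w W f alpha L v = u v - alpha * t * d v.
      rewrite !ffunE /d !ffunE.
      have lin (P : pred (edge E)) : \sum_(e | P e) W e * L e =
          (1 - t) * (\sum_(e | P e) W e * H e) + t * (\sum_(e | P e) W e * K e).
        rewrite !mulr_sumr -big_split; apply: eq_bigr => e _.
        by rewrite ffunE /=; ring.
      by rewrite !lin; ring.
    by ring.
  by rewrite -/u; lra.
rewrite leNgt; apply/negP => a_gt0.
(* At the step size t below, [alpha * t * b < a], contradicting [step]. *)
have c_gt0 : 0 < alpha * b + a by nra.
pose t := a / (alpha * b + a).
have t_gt0 : 0 < t by rewrite divr_gt0.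
have tE : t * (alpha * b + a) = a by rewrite divfK// gt_eqF.
have : 2 * alpha * t * a <= (alpha * t) ^+ 2 * b.
  by apply: step; rewrite ltW//= ler_pdivrMr// mul1r lerDr; nra.
rewrite (_ : 2 * alpha * t * a = (alpha * t) * (2 * a)); last ring.
rewrite expr2 -[leRHS]mulrA ler_pM2l; last exact: mulr_gt0.
nra.
Qed.

(** The energy exceeds its value at [u] by at least half the squared weighted distance to [u], which
    yields minimality and uniqueness together. *)
Lemma rof_argmin_residual w W f (alpha : R) H : (forall v, 0 < w v) -> 0 < alpha ->
  edge_ball H -> calibrates w W (dual_residual w W f alpha H) H ->
  argmin setT (rof_energy w (graph_tv w W) f alpha) = [set dual_residual w W f alpha H].
Proof.
move=> w_gt0 alpha_gt0 H_ball H_cal.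
set u := dual_residual _ _ _ _ _ in H_cal *.
set F := rof_energy _ _ _ _.
have gap (z : {ffun V -> R}) : F u + 2^-1 * (\sum_v w v * (z v - u v) ^+ 2) <= F z.
  rewrite /F /rof_energy (graph_tv_calibrates w_gt0 H_ball H_cal).
  have /(ler_wpM2l (ltW alpha_gt0)) := graph_tv_ge W z w_gt0 H_ball.
  apply: (le_trans _ \o lerD (lexx _)).
  (* What remains is an identity, vertex by vertex, because [f - u] is [alpha] times
     [gdiv w W H]. *)
  rewrite le_eqVlt; apply/orP; left; apply/eqP.
  rewrite /wdot !mulr_sumr -!big_split /=; apply: eq_bigr => v _.
  rewrite !real_normK ?num_real//.
  have -> : f v = u v + alpha * gdiv w W H v by rewrite ffunE subrK.
  by field.
have sum_ge0 (z : {ffun V -> R}) : 0 <= \sum_v w v * (z v - u v) ^+ 2.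
  by apply: sumr_ge0 => v _; rewrite mulr_ge0 ?sqr_ge0// ltW.
apply/seteqP; split => [z [_ z_min]|_ ->]; last first.
  by split=> // z _; have := gap z; have := sum_ge0 z; lra.
have := z_min u I; have := gap z; have := sum_ge0 z => ? ? ?.
have /eqP : \sum_v w v * (z v - u v) ^+ 2 = 0 by lra.
rewrite psumr_eq0 => [/allP z_eq|v _]; last by rewrite mulr_ge0 ?sqr_ge0// ltW.
apply/ffunP => v; have := z_eq v (mem_index_enum v).
by rewrite mulf_eq0 gt_eqF//= sqrf_eq0 subr_eq0 => /eqP.
Qed.

End WeightedGraph.

(** * Simultaneous minimality for all convex integrands *)

Theorem theorem7p4 (R : realType) (V : finType) (E : {set V * V})
    (E_oriented : oriented E) (E_connected : connected_graph E)
    (w : {ffun V -> R}) (w_gt0 : forall v, 0 < w v)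
    (W : {ffun edge E -> R}) (W_gt0 : forall e, 0 < W e)
    (f : {ffun V -> R}) (alpha : R) (alpha_gt0 : 0 < alpha) :
  let J := graph_tv w W in
  exists uf : {ffun V -> R},
    argmin setT (rof_energy w J f alpha) = [set uf] /\
    forall phi : R^o -> R^o, convex_function setT phi ->
      argmin [set [ffun v => f v - alpha * p v] | p in subdiff0 w J]
             (fun u : {ffun V -> R} => \sum_(v : V) phi (u v) * w v) uf.
Proof.
move=> J; have [H H_ball H_cal] := calibrated_residual W f w_gt0 alpha_gt0.
set u := dual_residual w W f alpha H in H_cal *.
exists u; split; first exact: rof_argmin_residual.
move=> phi /convex_subgradient[sigma sigmaP]; split.
  by exists (gdiv w W H); first exact: subdiff0_gdiv.
move=> _ [p p_sub <-].
(* Adding the subgradient inequalities at [x] and at [y] gives monotonicity. *)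
have sigma_homo : {homo sigma : x y / x <= y}.
  move=> x y; rewrite le_eqVlt => /predU1P[->//|xy].
  by have := sigmaP x y; have := sigmaP y x; nra.
pose s := [ffun v => sigma (u v)].
have s_cal : calibrates w W s H.
  exact: (calibrates_comp w_gt0 W_gt0 H_ball H_cal sigma_homo).
(* Test [p] against [s], whose total variation is attained by the same flow [H]. *)
have : alpha * wdot w p s <= alpha * wdot w s (gdiv w W H).
  rewrite ler_pM2l// -(graph_tv_calibrates w_gt0 H_ball s_cal); exact: p_sub.
rewrite -subr_ge0 /wdot !mulr_sumr -sumrB => sum_ge0.
rewrite -subr_ge0 -sumrB (le_trans sum_ge0)//; apply: ler_sum => v _.
rewrite -mulrBl [leRHS]mulrC.
(* The competitor minus [u] is [alpha] times [gdiv w W H - p], so each term is the linear part of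
   the subgradient inequality at [u v]. *)
have -> : alpha * (w v * s v * gdiv w W H v) - alpha * (w v * p v * s v) =
    w v * (s v * (f v - alpha * p v - u v)).
  by rewrite [u v]ffunE; ring.
rewrite ler_pM2l// [s v]ffunE [X in phi X]ffunE.
by have := sigmaP (u v) (f v - alpha * p v); lra.
Qed.
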